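(* Let $\mathcal G\in\mathbb A^{\mathbf p,m}$ be any admissible mesh and let $\mathcal M\subseteq\mathcal G$ be any set of marked elements. Then $\operatorname{ref}^{\mathbf p,m}(\mathcal G,\mathcal M)\in\mathbb A^{\mathbf p,m}$.
   Context: Parameters: $\mathbf p=(p_1,p_2,p_3)$ with each $p_i\ge 3$ an odd integer; $m\ge2$ an integer (grading parameter); positive integers $\tilde X,\tilde Y,\tilde Z$. Initial mesh: $\mathcal G_0=\{[x-1,x]\times[y-1,y]\times[z-1,z] : x\in\{1,\dots,\tilde X\},y\in\{1,\dots,\tilde Y\},z\in\{1,\dots,\tilde Z\}\}$, partitioning $\Omega=(0,\tilde X)\times(0,\tilde Y)\times(0,\tilde Z)$. Elements are closed axis-parallel boxes arising from elements of $\mathcal G_0$ by successive subdivision as below. The level of an element $K$ is $\ell(K)=-\log_m|K|$ ($|K|$ = volume), so elements of $\mathcal G_0$ have level $0$ and children of $K$ have level $\ell(K)+1$. Subdivision: for an element $K$, $\operatorname{child}(K)$ is the set of the $m$ boxes obtained by cutting $K$ into $m$ congruent boxes by planes orthogonal to the $x$-axis if $\ell(K)\equiv0$, to the $y$-axis if $\ell(K)\equiv1$, to the $z$-axis if $\ell(K)\equiv2\pmod 3$. For $K\in\mathcal G$, $\operatorname{subdiv}(\mathcal G,K)=(\mathcal G\setminus\{K\})\cup\operatorname{child}(K)$; for $\mathcal M=\{K_1,\dots,K_J\}\subseteq\mathcal G$, $\operatorname{subdiv}(\mathcal G,\mathcal M)$ is the result of successively subdividing all $K_j$ (in any order). Patches: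 for $x\in\overline\Omega$, $\operatorname{Dist}(K,x)\in\mathbb R^3$ is the componentwise absolute value of $\operatorname{mid}(K)-x$, with $\operatorname{mid}(K)$ the midpoint of $K$. For $k\ge0$, $$\mathbf D^{\mathbf p,m}(k)=\begin{cases}m^{-k/3}(p_1+\frac32,\,p_2+\frac32,\,p_3+\frac32)&k\equiv0\bmod 3,\\ m^{-(k-1)/3}(\frac{p_1+3/2}m,\,p_2+\frac32,\,p_3+\frac32)&k\equiv1\bmod 3,\\ m^{-(k-2)/3}(\frac{p_1+3/2}m,\,\frac{p_2+3/2}m,\,p_3+\frac32)&k\equiv2\bmod 3.\end{cases}$$ Set $U^{\mathbf p,m}(K)=\{x\in\Omega:\operatorname{Dist}(K,x)<\mathbf D^{\mathbf p,m}(\ell(K))\}$ (componentwise inequality), and the $(\mathbf p,m)$-patch $\mathcal G^{\mathbf p,m}(K)=\{K'\in\mathcal G: K'\cap U^{\mathbf p,m}(K)\ne\emptyset\}$. Admissibility: for $K\in\mathcal G$, the subdivision $\operatorname{subdiv}(\mathcal G,K)$ is admissible if $\ell(K')\ge\ell(K)$ for all $K'\in\mathcal G^{\mathbf p,m}(K)$. For $\mathcal M=\{K_1,\dots,K_J\}\subseteq\mathcal G$, $\operatorname{subdiv}(\mathcal G,\mathcal M)$ is admissible if for some ordering of the $K_j$ it is a concatenation of admissible subdivisions of single elements. A mesh $\mathcal G$ is admissible if there are meshes $\mathcal G_1,\dots,\mathcal G_J=\mathcal G$ (starting from the initial mesh $\mathcal G_0$) and $\mathcal M_j\subseteq\mathcal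 G_j$ such that $\mathcal G_{j+1}=\operatorname{subdiv}(\mathcal G_j,\mathcal M_j)$ is an admissible subdivision for all $j=0,\dots,J-1$. $\mathbb A^{\mathbf p,m}$ denotes the set of all admissible meshes, including $\mathcal G_0$. Refinement algorithm: for a mesh $\mathcal G$ and $\mathcal M\subseteq\mathcal G$, the closure $\operatorname{clos}^{\mathbf p,m}(\mathcal G,\mathcal M)$ is obtained by starting with $\widetilde{\mathcal M}=\mathcal M$ and repeatedly, for all $K\in\widetilde{\mathcal M}$, replacing $\widetilde{\mathcal M}$ by $\widetilde{\mathcal M}\cup\{K'\in\mathcal G^{\mathbf p,m}(K):\ell(K')<\ell(K)\}$, until $\widetilde{\mathcal M}$ stops growing. Then $\operatorname{ref}^{\mathbf p,m}(\mathcal G,\mathcal M)=\operatorname{subdiv}(\mathcal G,\operatorname{clos}^{\mathbf p,m}(\mathcal G,\mathcal M))$. *)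

(* Defs.v *)
From mathcomp Require Import all_boot all_order all_algebra.
From mathcomp Require Import finmap.
From mathcomp Require Import boolp reals exp.

Set Implicit Arguments.
Unset Strict Implicit.
Unset Printing Implicit Defensive.

Import Order.TTheory GRing.Theory Num.Theory.

Local Open Scope fset_scope.
Local Open Scope ring_scope.

(* A box is given by its lower and upper corners; the coordinate axes x, y, z
   are the indices 0, 1, 2 of 'I_3.  The parameters (p_1, p_2, p_3) and the
   size of the domain (X, Y, Z) are functions p, N : 'I_3 -> nat. *)
Definition box (R : realType) : choiceType := ('rV[R]_3 * 'rV[R]_3)%type.

Definition mesh (R : realType) : Type := {fset box R}.

Definition in_box (R : realType) (K : box R) (x : 'rV[R]_3) : Prop :=
  forall i, K.1 0 i <= x 0 i <= K.2 0 i.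

Definition volume (R : realType) (K : box R) : R :=
  \prod_i (K.2 0 i - K.1 0 i).

(* -log_m |K| is a natural number on every box obtained by subdivision (see
   levelE); truncn only turns this real into a nat. *)
Definition level (R : realType) (m : nat) (K : box R) : nat :=
  Num.truncn (- (ln (volume K) / ln (m%:R : R))).

Lemma levelE (R : realType) (m : nat) (K : box R) (k : nat) :
  (1 < m)%N -> volume K = m%:R ^- k -> level m K = k.
Proof.
move=> m_gt1 vK; rewrite /level vK.
have m_gt0 : 0 < (m%:R : R) by rewrite ltr0n (ltn_trans _ m_gt1).
have lnm : ln (m%:R : R) != 0 by rewrite gt_eqF// ln_gt0// ltr1n.
rewrite lnV ?posrE ?exprn_gt0// lnXn// mulNr opprK -(mulr_natl _ k) mulfK//.
exact: natrK.
Qed.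

(* The initial mesh: c ranges over the triples (x-1, y-1, z-1). *)
Definition initial_mesh (R : realType) (N : 'I_3 -> nat) : mesh R :=
  [fset ((\row_i (c i)%:R, \row_i (c i).+1%:R) : box R)
     | c : {dffun forall i : 'I_3, 'I_(N i)} in predT].

Definition domain (R : realType) (N : 'I_3 -> nat) (x : 'rV[R]_3) : Prop :=
  forall i, 0 < x 0 i < (N i)%:R.

(* The j-th of the m congruent slices of K, cut orthogonally to the axis a. *)
Definition slice (R : realType) (m : nat) (a : 'I_3) (K : box R) (j : nat) :
    box R :=
  let h := (K.2 0 a - K.1 0 a) / m%:R in
  (\row_i (if i == a then K.1 0 a + j%:R * h else K.1 0 i),
   \row_i (if i == a then K.1 0 a + j.+1%:R * h else K.2 0 i)).

Definition child (R : realType) (m : nat) (K : box R) : {fset box R} :=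
  [fset slice m (inord (level m K %% 3)) K (j : 'I_m) | j in predT].

Definition subdiv1 (R : realType) (m : nat) (G : mesh R) (K : box R) : mesh R :=
  (G `\ K) `|` child m K.

(* The order of subdivision is irrelevant on a mesh whose elements have
   disjoint interiors; we use the enumeration order of M. *)
Definition subdiv (R : realType) (m : nat) (G : mesh R) (M : {fset box R}) :
    mesh R :=
  foldl (subdiv1 m) G (enum_fset M).

Definition mid (R : realType) (K : box R) : 'rV[R]_3 :=
  2%:R^-1 *: (K.1 + K.2).

Definition Dist (R : realType) (K : box R) (x : 'rV[R]_3) : 'rV[R]_3 :=
  \row_i `|mid K 0 i - x 0 i|.

(* The axes i < k mod 3 have already been cut once more than the others. *)
Definition D (R : realType) (p : 'I_3 -> nat) (m k : nat) : 'rV[R]_3 :=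
  m%:R ^- (k %/ 3) *:
    \row_i (let d := (p i)%:R + 3%:R / 2%:R in
            if (i < k %% 3)%N then d / m%:R else d).

Definition U (R : realType) (p : 'I_3 -> nat) (m : nat) (N : 'I_3 -> nat)
    (K : box R) (x : 'rV[R]_3) : Prop :=
  domain N x /\ forall i, Dist K x 0 i < D R p m (level m K) 0 i.

Definition patch (R : realType) (p : 'I_3 -> nat) (m : nat) (N : 'I_3 -> nat)
    (G : mesh R) (K : box R) : {fset box R} :=
  [fset K' in G | `[< exists x, in_box K' x /\ U p m N K x >]].

Definition admissible_subdiv1 (R : realType) (p : 'I_3 -> nat) (m : nat)
    (N : 'I_3 -> nat) (G : mesh R) (K : box R) : Prop :=
  K \in G /\
  forall K', K' \in patch p m N G K -> (level m K <= level m K')%N.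

Fixpoint admissible_subdiv_seq (R : realType) (p : 'I_3 -> nat) (m : nat)
    (N : 'I_3 -> nat) (G : mesh R) (s : seq (box R)) : Prop :=
  if s is K :: s' then
    admissible_subdiv1 p m N G K /\
    admissible_subdiv_seq p m N (subdiv1 m G K) s'
  else True.

Definition admissible_subdiv (R : realType) (p : 'I_3 -> nat) (m : nat)
    (N : 'I_3 -> nat) (G : mesh R) (M : {fset box R}) : Prop :=
  exists s : seq (box R),
    perm_eq s (enum_fset M) /\ admissible_subdiv_seq p m N G s.

Definition admissible_mesh (R : realType) (p : 'I_3 -> nat) (m : nat)
    (N : 'I_3 -> nat) (G : mesh R) : Prop :=
  exists (J : nat) (Gs : nat -> mesh R) (Ms : nat -> {fset box R}),
    [/\ Gs 0%N = initial_mesh R N,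
        Gs J = G &
        forall j, (j < J)%N ->
          [/\ Ms j `<=` Gs j,
              Gs j.+1 = subdiv m (Gs j) (Ms j) &
              admissible_subdiv p m N (Gs j) (Ms j)]].

Definition clos_step (R : realType) (p : 'I_3 -> nat) (m : nat)
    (N : 'I_3 -> nat) (G : mesh R) (M : {fset box R}) : {fset box R} :=
  M `|` \bigcup_(K <- enum_fset M)
          [fset K' in patch p m N G K | (level m K' < level m K)%N].

Lemma clos_step_sub (R : realType) (p : 'I_3 -> nat) (m : nat)
    (N : 'I_3 -> nat) (G : mesh R) (M B : {fset box R}) :
  M `<=` B -> G `<=` B -> clos_step p m N G M `<=` B.
Proof.
move=> MB GB; rewrite fsubUset MB /=.
apply/fsubsetP => K' /bigfcupP[K _].
by rewrite !inE => /andP[/andP[K'G _] _]; exact: (fsubsetP GB).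
Qed.

Lemma clos_stops (R : realType) (p : 'I_3 -> nat) (m : nat)
    (N : 'I_3 -> nat) (G : mesh R) (M : {fset box R}) :
  exists n, iter n.+1 (clos_step p m N G) M == iter n (clos_step p m N G) M.
Proof.
set f := clos_step p m N G.
have subB n : iter n f M `<=` M `|` G.
  elim: n => [|n IHn]; first exact: fsubsetUl.
  by rewrite iterS clos_step_sub// fsubsetUr.
have [//|/forallNP nofix] := pselect (exists n, iter n.+1 f M == iter n f M).
have grow n : (n <= #|` iter n f M|)%N.
  elim: n => // n IHn; apply: leq_ltn_trans IHn _; apply: fproper_ltn_card.
  rewrite fproperEneq iterS fsubsetUl andbT eq_sym.
  by apply/negP; exact: nofix.
have := leq_trans (grow #|` M `|` G|.+1) (fsubset_leq_card (subB _)).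
by rewrite ltnn.
Qed.

(* Iterate until the set of marked elements stops growing. *)
Definition clos (R : realType) (p : 'I_3 -> nat) (m : nat) (N : 'I_3 -> nat)
    (G : mesh R) (M : {fset box R}) : {fset box R} :=
  iter (ex_minn (clos_stops p m N G M)) (clos_step p m N G) M.

Definition refine (R : realType) (p : 'I_3 -> nat) (m : nat) (N : 'I_3 -> nat)
    (G : mesh R) (M : {fset box R}) : mesh R :=
  subdiv m G (clos p m N G M).

(* Main.v *)
Require Import Defs.
From mathcomp Require Import all_boot all_order all_algebra.
From mathcomp Require Import finmap.
From mathcomp Require Import reals.
From mathcomp Require Import boolp zify ring lra.

(** The whole proof rests on local grading: in an admissible mesh, an element
that meets the patch neighbourhood U(K) of K is at most one level coarser than
K.

Suppose the mesh is graded in this sense, and subdivide the elements of the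
closure in the order of increasing level ([sorted_closed_admissible]).  When
the turn of K comes, an element K' of the current mesh that meets U(K) cannot
be coarser than K.  If K' belongs to the original mesh and is coarser, then it
is in the closure, hence it has already been subdivided and is gone.  If K' is
a child created on the way, its parent also meets U(K), so the parent is at
most one level coarser than K, and K' is not coarser at all.

Grading itself is preserved by every admissible subdivision of one element K
([good_subdiv1]), so it holds by induction along the history of the mesh.  Two
facts are used: a child B of K is contained in K, so that whatever meets B
meets K; and U(c) is contained in U(K) for a child c of K ([U_child]), so that
an element meeting U(c) meets U(K) and is not coarser than K, by admissibility.

The mesh reached from a marked set is computed in one fixed order, while
admissibility is granted for another one.  The two results agree
([subdiv_perm]) because no child of an element of the mesh is itself an
element of the mesh; this follows from the disjointness of the interiors,
which is therefore carried along as part of the invariant [good_mesh]. *)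

Set Implicit Arguments.
Unset Strict Implicit.
Unset Printing Implicit Defensive.

Import Order.TTheory GRing.Theory Num.Theory.

Local Open Scope fset_scope.
Local Open Scope ring_scope.

(** * Side lengths, levels and children *)

Definition cut_axis (k : nat) : 'I_3 := inord (k %% 3).

(** A box of level k has been cut along the axes 0, 1, 2, 0, 1, 2, ... in turn,
k times in all; this is the number of cuts orthogonal to the axis i. *)
Definition cuts (k : nat) (i : 'I_3) : nat := (k %/ 3 + (i < k %% 3))%N.

Lemma cutsS (k : nat) (i : 'I_3) :
  cuts k.+1 i = (cuts k i + (i == cut_axis k))%N.
Proof.
rewrite /cuts -val_eqE /= inordK ?ltn_pmod//.
by case: i => i /= i3; do !case: ltnP => ?; case: eqP => ?; lia.
Qed.

Lemma sum_cuts (k : nat) : (\sum_i cuts k i = k)%N.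
Proof.
elim: k => [|k IHk]; first by rewrite big1.
under eq_bigr do rewrite cutsS.
by rewrite big_split /= IHk (bigD1 (cut_axis k))//= eqxx big1 ?addn1// => i /negPf->.
Qed.

Definition side (R : realType) (m k : nat) (i : 'I_3) : R := m%:R ^- cuts k i.

Lemma sideS (R : realType) (m k : nat) (i : 'I_3) :
  side R m k.+1 i = if i == cut_axis k then side R m k i / m%:R else side R m k i.
Proof.
rewrite /side cutsS; case: eqP => _; last by rewrite addn0.
by rewrite addn1 exprSr invfM.
Qed.

Lemma side_gt0 (R : realType) (m k : nat) (i : 'I_3) :
  (1 < m)%N -> 0 < side R m k i.
Proof. by move=> m1; rewrite invr_gt0 exprn_gt0// ltr0n ltnW. Qed.

(** The extent of the neighbourhood U(K) is a constant multiple of the side of K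
in each direction, which is why it scales with K under subdivision. *)
Lemma D_side (R : realType) (p : 'I_3 -> nat) (m k : nat) (i : 'I_3) :
  D R p m k 0 i = side R m k i * ((p i)%:R + 3%:R / 2%:R).
Proof.
rewrite /D !mxE /side /cuts; case: ifP => _; last by rewrite addn0.
by rewrite addn1 exprSr invfM -mulrA [m%:R^-1 * _]mulrC.
Qed.

Definition has_sides (R : realType) (m k : nat) (K : box R) : Prop :=
  forall i, K.2 0 i - K.1 0 i = side R m k i.

(** The cuts add up to k over the three axes, so the volume is the inverse of
the k-th power of m. *)
Lemma level_has_sides (R : realType) (m k : nat) (K : box R) :
  (1 < m)%N -> has_sides m k K -> level m K = k.
Proof.
move=> m1 sK; apply: levelE => //; rewrite /volume.
under eq_bigr do rewrite sK /side -exprVn.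
by rewrite prodrXr sum_cuts exprVn.
Qed.

Definition well_shaped (R : realType) (m : nat) (K : box R) : Prop :=
  has_sides m (level m K) K.

Lemma has_sides_well_shaped (R : realType) (m k : nat) (K : box R) :
  (1 < m)%N -> has_sides m k K -> well_shaped m K.
Proof. by move=> m1 sK; rewrite /well_shaped (level_has_sides m1 sK). Qed.

Lemma childP (R : realType) (m : nat) (K c : box R) :
  reflect (exists2 j, (j < m)%N & c = slice m (cut_axis (level m K)) K j)
    (c \in child m K).
Proof.
apply: (iffP idP) => [/imfsetP[j _ ->]|[j jm ->]]; first by exists (j : nat).
by apply/imfsetP; exists (Ordinal jm).
Qed.

Lemma slice_off_axis (R : realType) (m : nat) (a i : 'I_3) (K : box R) (j : nat) :
  i != a -> (slice m a K j).1 0 i = K.1 0 i /\ (slice m a K j).2 0 i = K.2 0 i.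
Proof. by move=> /negPf ia; rewrite !mxE ia. Qed.

Lemma slice_on_axis (R : realType) (m : nat) (a : 'I_3) (K : box R) (j : nat) :
  let h := (K.2 0 a - K.1 0 a) / m%:R in
  (slice m a K j).1 0 a = K.1 0 a + j%:R * h /\
  (slice m a K j).2 0 a = K.1 0 a + j%:R * h + h.
Proof. by move=> h; rewrite !mxE eqxx -/h -natr1 mulrDl mul1r addrA. Qed.

Lemma child_has_sides (R : realType) (m : nat) (K c : box R) :
  well_shaped m K -> c \in child m K -> has_sides m (level m K).+1 c.
Proof.
move=> sK /childP[j _ ->] i; rewrite sideS; have [->|ia] := eqVneq.
  by have [-> ->] := slice_on_axis m (cut_axis (level m K)) K j; rewrite addrC addKr sK.
by have [-> ->] := slice_off_axis m K j ia; rewrite sK.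
Qed.

Lemma child_level (R : realType) (m : nat) (K c : box R) :
  (1 < m)%N -> well_shaped m K -> c \in child m K -> level m c = (level m K).+1.
Proof. by move=> m1 sK cK; exact/level_has_sides/child_has_sides. Qed.

Lemma child_corners (R : realType) (m : nat) (K c : box R) (i : 'I_3) :
  (1 < m)%N -> well_shaped m K -> c \in child m K ->
  K.1 0 i <= c.1 0 i /\ c.2 0 i <= K.2 0 i.
Proof.
move=> m1 sK /childP[j jm ->]; set a := cut_axis _.
have [->|ia] := eqVneq i a; last by have [-> ->] := slice_off_axis m K j ia.
have [-> ->] := slice_on_axis m a K j; set h := (_ - _) / _.
have m0 : 0 < m%:R :> R by rewrite ltr0n ltnW.
have h0 : 0 < h by rewrite divr_gt0// sK side_gt0.
split; first by rewrite lerDl mulr_ge0// ltW.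
have jm' : j%:R + 1 <= m%:R :> R by rewrite natr1 ler_nat.
have -> : K.2 0 a = K.1 0 a + m%:R * h.
  by rewrite mulrC divfK ?gt_eqF//; ring.
by rewrite -addrA lerD2l -{2}[h]mul1r -mulrDl ler_pM2r.
Qed.

(** * Containment of a child in its parent *)

Lemma in_box_child (R : realType) (m : nat) (K c : box R) (x : 'rV[R]_3) :
  (1 < m)%N -> well_shaped m K -> c \in child m K -> in_box c x -> in_box K x.
Proof.
move=> m1 sK cK xc i; have [lo up] := child_corners i m1 sK cK.
by have /andP[cx xc'] := xc i; rewrite (le_trans lo cx) (le_trans xc' up).
Qed.

Definition in_interior (R : realType) (K : box R) (x : 'rV[R]_3) : Prop :=
  forall i, K.1 0 i < x 0 i < K.2 0 i.

Lemma in_interior_child (R : realType) (m : nat) (K c : box R) (x : 'rV[R]_3) :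
  (1 < m)%N -> well_shaped m K -> c \in child m K ->
  in_interior c x -> in_interior K x.
Proof.
move=> m1 sK cK xc i; have [lo up] := child_corners i m1 sK cK.
by have /andP[cx xc'] := xc i; rewrite (le_lt_trans lo cx) (lt_le_trans xc' up).
Qed.

Lemma mid_in_interior (R : realType) (m : nat) (K : box R) :
  (1 < m)%N -> well_shaped m K -> in_interior K (mid K).
Proof.
move=> m1 sK i; have := side_gt0 R (level m K) i m1; rewrite -sK !mxE => ?.
by apply/andP; split; lra.
Qed.

(** Only the cut direction a matters.  There, with h the side of the child and
d = p + 3/2, the neighbourhoods extend to d h and m d h from the respective
midpoints, and these midpoints are at most (m - 1) h / 2 apart; so the
inclusion holds as soon as d is at least 1/2. *)
Lemma U_child (R : realType) (p : 'I_3 -> nat) (m : nat) (N : 'I_3 -> nat)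
    (K c : box R) (x : 'rV[R]_3) :
  (1 < m)%N -> well_shaped m K -> c \in child m K -> U p m N c x -> U p m N K x.
Proof.
move=> m1 sK cK [Nx xc]; split=> // i; have := xc i.
rewrite (child_level m1 sK cK) !D_side sideS.
case/childP: cK => j jm ->; set a := cut_axis _.
set d : R := _ + _; have d1 : 1 / 2 <= d.
  have : 0 <= (p i)%:R :> R by []. by rewrite /d; lra.
rewrite /Dist !mxE; have [->|ia] := eqVneq i a; last by [].
rewrite -sK; set h := (_ - _) / _.
have m0 : 0 < m%:R :> R by rewrite ltr0n ltnW.
have h0 : 0 < h by rewrite divr_gt0// sK side_gt0.
have -> : K.2 0 a = K.1 0 a + m%:R * h.
  by rewrite mulrC divfK ?gt_eqF//; ring.
have jm' : j%:R + 1 <= m%:R :> R by rewrite natr1 ler_nat.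
have j0 : 0 <= j%:R :> R by [].
rewrite -[j.+1%:R]natr1 !ltr_norml => /andP[lo up].
have jh0 : 0 <= j%:R * h by rewrite mulr_ge0// ltW.
have jh1 : j%:R * h + h <= m%:R * h by rewrite -{2}[h]mul1r -mulrDl ler_pM2r.
(* The slack (m - 1) h (d - 1/2) between m d h and d h + (m - 1) h / 2. *)
have dh : 0 <= (m%:R * h - h) * (d - 1 / 2).
  by rewrite mulr_ge0 ?subr_ge0//; lra.
have -> : (K.1 0 a + m%:R * h - K.1 0 a) * d = m%:R * h * d by ring.
apply/andP; split; nra.
Qed.

(** * The invariant of admissible meshes *)

(** Disjointness of interiors is phrased through a common interior point, and
grading is the property that makes the refinement algorithm work. *)
Record good_mesh (R : realType) (p : 'I_3 -> nat) (m : nat) (N : 'I_3 -> nat)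
    (G : mesh R) : Prop := GoodMesh {
  good_shaped : forall K, K \in G -> well_shaped m K;
  good_disjoint : forall K K' x, K \in G -> K' \in G ->
    in_interior K x -> in_interior K' x -> K = K';
  good_graded : forall K K', K \in G -> K' \in patch p m N G K ->
    (level m K <= (level m K').+1)%N }.

Lemma in_patch (R : realType) (p : 'I_3 -> nat) (m : nat) (N : 'I_3 -> nat)
    (G : mesh R) (K K' : box R) :
  K' \in patch p m N G K <->
  K' \in G /\ exists x, in_box K' x /\ U p m N K x.
Proof.
rewrite /patch !inE /=; split=> [/andP[? /asboolP]//|[-> ?]].
exact/asboolP.
Qed.

Lemma in_subdiv1 (R : realType) (m : nat) (G : mesh R) (K K' : box R) :
  (K' \in subdiv1 m G K) = (K' \in G) && (K' != K) || (K' \in child m K).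
Proof. by rewrite !inE andbC. Qed.

(** On the cut axis the slices j < j' are separated by the upper face of the
slice j. *)
Lemma child_disjoint (R : realType) (m : nat) (K c c' : box R) (x : 'rV[R]_3) :
  (1 < m)%N -> well_shaped m K -> c \in child m K -> c' \in child m K ->
  in_interior c x -> in_interior c' x -> c = c'.
Proof.
move=> m1 sK /childP[j _ ->] /childP[j' _ ->]; set a := cut_axis _ => xj xj'.
suff no_lt i i' : in_interior (slice m a K i) x ->
    in_interior (slice m a K i') x -> (i' <= i)%N.
  by congr (slice _ _ _ _); apply/eqP; rewrite eqn_leq !no_lt.
move=> /(_ a) + /(_ a).
have [-> ->] := slice_on_axis m a K i; have [-> ->] := slice_on_axis m a K i'.
set h := _ / _ => /andP[_ up] /andP[lo _]; rewrite leqNgt; apply/negP => ii'.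
have h0 : 0 < h by rewrite divr_gt0 ?sK ?side_gt0// ltr0n ltnW.
have : (i%:R + 1) * h <= i'%:R * h by rewrite ler_pM2r// natr1 ler_nat.
by rewrite mulrDl mul1r => ?; lra.
Qed.

(** For grading, consider a pair A, B of the new mesh with B meeting U(A).  If B
is a child of K, then K meets U(A) and the grading of the old mesh applies to
A and K; if A is a child of K, then B meets U(K) and admissibility applies. *)
Lemma good_subdiv1 (R : realType) (p : 'I_3 -> nat) (m : nat) (N : 'I_3 -> nat)
    (G : mesh R) (K : box R) :
  (1 < m)%N -> good_mesh p m N G -> admissible_subdiv1 p m N G K ->
  good_mesh p m N (subdiv1 m G K).
Proof.
move=> m1 [sG dG qG] [KG admK]; have sK := sG K KG.
split=> [A|A B x|A B]; rewrite in_subdiv1.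
- case/orP=> [/andP[/sG//]|AK].
  exact: has_sides_well_shaped m1 (child_has_sides sK AK).
- have apart C c : C \in G -> C != K -> c \in child m K ->
      in_interior C x -> in_interior c x -> C = c.
    move=> CG /eqP CK cK xC xc; case: CK.
    exact: dG CG KG xC (in_interior_child m1 sK cK xc).
  rewrite in_subdiv1.
  case/orP=> [/andP[AG AK]|AK] /orP[/andP[BG BK]|BK] xA xB.
  + exact: dG xA xB.
  + exact: apart xA xB.
  + by apply: esym; exact: (apart B A).
  + exact: child_disjoint BK xA xB.
- move=> AG' /in_patch[]; rewrite in_subdiv1 => BG' [x [xB xA]].
  case/orP: AG' => [/andP[AG AK]|AK]; case/orP: BG' => [/andP[BG BK]|BK].
  + by apply: qG => //; apply/in_patch; split=> //; exists x.
  + rewrite (child_level m1 sK BK); apply: leqW; apply: qG => //.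
    apply/in_patch; split=> //; exists x; split=> //.
    exact: in_box_child m1 sK BK xB.
  + rewrite (child_level m1 sK AK) ltnS; apply: admK.
    apply/in_patch; split=> //; exists x; split=> //.
    exact: U_child m1 sK AK xA.
  + by rewrite (child_level m1 sK AK) (child_level m1 sK BK).
Qed.

Lemma good_subdiv_seq (R : realType) (p : 'I_3 -> nat) (m : nat)
    (N : 'I_3 -> nat) (G : mesh R) (s : seq (box R)) :
  (1 < m)%N -> good_mesh p m N G -> admissible_subdiv_seq p m N G s ->
  good_mesh p m N (foldl (subdiv1 m) G s).
Proof.
move=> m1; elim: s G => //= K s IHs G gG [admK adms].
exact/IHs/adms/good_subdiv1.
Qed.

(** The midpoint of a child is interior to the parent, so a child lying in the
mesh would be equal to its parent, whose level is different. *)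
Lemma child_notin (R : realType) (p : 'I_3 -> nat) (m : nat) (N : 'I_3 -> nat)
    (G : mesh R) (K c : box R) :
  (1 < m)%N -> good_mesh p m N G -> K \in G -> c \in child m K -> c \notin G.
Proof.
move=> m1 [sG dG _] KG cK; apply/negP => cG.
have xc := mid_in_interior m1 (sG c cG).
have := child_level m1 (sG K KG) cK.
rewrite (dG c K _ cG KG xc (in_interior_child m1 (sG K KG) cK xc)) => /eqP.
by rewrite -[X in X == _]addn0 -addn1 eqn_add2l.
Qed.

(** * Independence of the order of subdivision *)

(** As no listed element has a listed child, no subdivision undoes or repeats
another one, and the result is described without reference to the order. *)
Lemma in_foldl_subdiv1 (R : realType) (m : nat) (G : mesh R) (s : seq (box R)) :
  uniq s -> (forall K c, K \in s -> c \in child m K -> c \notin s) ->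
  foldl (subdiv1 m) G s =i
  [pred A | (A \in G) && (A \notin s) || has (fun K => A \in child m K) s].
Proof.
elim: s G => [|K s IHs] G /=; first by move=> _ _ A; rewrite inE /= andbT orbF.
move=> /andP[Ks us] nch A; rewrite IHs//; last first.
  move=> L c Ls cL; apply: contra (nch L c _ cL); rewrite inE ?Ls ?orbT//.
  by move=> ->; rewrite orbT.
rewrite !inE negb_or; have [AK /=|_ /=] := boolP (A \in child m K).
  have := nch K A (mem_head _ _) AK; rewrite inE negb_or => /andP[-> ->].
  by rewrite !orbT.
by rewrite orbF -andbA andbCA.
Qed.

Lemma subdiv_perm (R : realType) (p : 'I_3 -> nat) (m : nat) (N : 'I_3 -> nat)
    (G : mesh R) (s t : seq (box R)) :
  (1 < m)%N -> good_mesh p m N G -> uniq s -> {subset s <= G} -> perm_eq s t ->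
  foldl (subdiv1 m) G s = foldl (subdiv1 m) G t.
Proof.
move=> m1 gG us sG st.
have nch K c : K \in s -> c \in child m K -> c \notin s.
  by move=> /sG KG cK; apply: contra (child_notin m1 gG KG cK) => /sG.
apply/fsetP => A; rewrite !in_foldl_subdiv1 -?(perm_uniq st)//; last first.
  by move=> K c; rewrite -!(perm_mem st); exact: nch.
by rewrite !inE (perm_mem st) (perm_has _ st).
Qed.

(** * Admissible meshes are graded *)

Lemma good_initial (R : realType) (p : 'I_3 -> nat) (m : nat) (N : 'I_3 -> nat) :
  (1 < m)%N -> good_mesh p m N (initial_mesh R N).
Proof.
move=> m1; have sides0 K : K \in initial_mesh R N -> has_sides m 0 K.
  case/imfsetP=> c _ -> i /=; rewrite !mxE -natr1 addrC addKr.
  by rewrite /side /cuts ltn0 expr0 invr1.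
split=> [K /sides0 /has_sides_well_shaped|K K' x|K K' K0]; first exact.
- case/imfsetP=> c _ -> /imfsetP[c' _ ->] xc xc'.
  have same i : c i = c' i :> nat.
    have /andP[] := xc i; have /andP[] := xc' i; rewrite !mxE => lo' up' lo up.
    have := lt_trans lo' up; have := lt_trans lo up'.
    by rewrite !ltr_nat !ltnS => le le'; apply/eqP; rewrite eqn_leq le le'.
  by congr pair; apply/rowP => i; rewrite !mxE same.
- by rewrite (level_has_sides m1 (sides0 K K0)).
Qed.

Lemma good_admissible (R : realType) (p : 'I_3 -> nat) (m : nat)
    (N : 'I_3 -> nat) (G : mesh R) :
  (1 < m)%N -> admissible_mesh p m N G -> good_mesh p m N G.
Proof.
move=> m1 [J [Gs [Ms [G0 <- step]]]].
elim: J step => [|J IHJ] step; first by rewrite G0; exact: good_initial.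
have gJ : good_mesh p m N (Gs J) by apply: IHJ => j jJ; apply: step; exact: leqW.
have [MG -> [s [sM adms]]] := step J (leqnn _).
rewrite /subdiv (@subdiv_perm _ p m N _ _ s)//; last by rewrite perm_sym.
- exact: good_subdiv_seq.
- exact/fsubsetP.
Qed.

Lemma admissible_subdiv_step (R : realType) (p : 'I_3 -> nat) (m : nat)
    (N : 'I_3 -> nat) (G : mesh R) (M : {fset box R}) :
  admissible_mesh p m N G -> M `<=` G -> admissible_subdiv p m N G M ->
  admissible_mesh p m N (subdiv m G M).
Proof.
move=> [J [Gs [Ms [G0 GJ step]]]] MG admM.
exists J.+1, (fun j => if (j <= J)%N then Gs j else subdiv m G M).
exists (fun j => if (j < J)%N then Ms j else M); split=> //; first by rewrite ltnn.
move=> j /=; rewrite ltnS => jJ; rewrite jJ; case: ltnP => [|Jj]; first exact: step.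
by have -> : j = J; [apply/eqP; rewrite eqn_leq jJ | rewrite GJ].
Qed.

(** * Subdivision of a closed set of elements *)

(** After the first element K has been subdivided, the remaining list is still
closed: a child B of K in the patch of a remaining element A is not coarser
than A, because K is in the patch of A in the old mesh, where grading gives
that the level of A is at most one more than that of K. *)
Lemma sorted_closed_admissible (R : realType) (p : 'I_3 -> nat) (m : nat)
    (N : 'I_3 -> nat) (G : mesh R) (s : seq (box R)) :
  (1 < m)%N -> good_mesh p m N G ->
  sorted (relpre (level m) leq) s -> uniq s -> {subset s <= G} ->
  (forall K K', K \in s -> K' \in patch p m N G K ->
     (level m K' < level m K)%N -> K' \in s) ->
  admissible_subdiv_seq p m N G s.
Proof.
move=> m1; elim: s G => //= K s IHs G gG.
rewrite path_sortedE => [/andP[/allP minK ss] /andP[Ks us] sG clos_s|]; last first.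
  by move=> ? ? ?; exact: leq_trans.
have KG : K \in G by rewrite sG ?mem_head.
have admK : admissible_subdiv1 p m N G K.
  split=> // K' K'K; rewrite leqNgt; apply/negP => lt_K'K.
  have := clos_s K K' (mem_head _ _) K'K lt_K'K; rewrite inE => /orP[/eqP eK'|].
    by rewrite eK' ltnn in lt_K'K.
  by move=> /minK /=; rewrite leqNgt lt_K'K.
split=> //; apply: IHs => //; first exact: good_subdiv1.
  move=> A As; rewrite in_subdiv1 sG ?inE ?As ?orbT//=.
  by apply/orP; left; apply: contraNneq Ks => <-.
move=> A B As /in_patch[]; rewrite in_subdiv1 => BG' [x [xB xA]] lt_BA.
have AG : A \in G by rewrite sG// inE As orbT.
case/orP: BG' => [/andP[BG BK]|BK].
  have BA : B \in patch p m N G A by apply/in_patch; split=> //; exists x.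
  have := clos_s A B; rewrite !(in_cons, As, orbT) (negPf BK) /= => clos_AB.
  exact: clos_AB.
have sK := good_shaped gG KG.
suff : (level m A <= (level m K).+1)%N.
  by rewrite -(child_level m1 sK BK) leqNgt lt_BA.
apply: (good_graded gG) => //; apply/in_patch; split=> //; exists x; split=> //.
exact: in_box_child m1 sK BK xB.
Qed.

Lemma clos_sub (R : realType) (p : 'I_3 -> nat) (m : nat) (N : 'I_3 -> nat)
    (G : mesh R) (M : {fset box R}) :
  M `<=` G -> clos p m N G M `<=` G.
Proof.
move=> MG; rewrite /clos; elim: ex_minn => // n IHn.
by rewrite iterS clos_step_sub.
Qed.

Lemma clos_closed (R : realType) (p : 'I_3 -> nat) (m : nat) (N : 'I_3 -> nat)
    (G : mesh R) (M : {fset box R}) (K K' : box R) :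
  K \in clos p m N G M -> K' \in patch p m N G K ->
  (level m K' < level m K)%N -> K' \in clos p m N G M.
Proof.
rewrite /clos; case: ex_minnP => n /= /eqP fix_n _ KC K'K lt_K'K.
(* The iteration has stopped, so one more step adds nothing. *)
rewrite -fix_n {1}/clos_step in_fsetU; apply/orP; right.
by apply/bigfcupP; exists K; rewrite ?KC// in_fset /= inE /= K'K.
Qed.

Theorem theorem3p3 (R : realType) (p : 'I_3 -> nat) (m : nat) (N : 'I_3 -> nat)
    (hp : forall i, (3 <= p i)%N /\ odd (p i))
    (hm : (2 <= m)%N)
    (hN : forall i, (0 < N i)%N)
    (G : mesh R) (hG : admissible_mesh p m N G)
    (M : {fset box R}) (hM : M `<=` G) :
  admissible_mesh p m N (refine p m N G M).
Proof.
have CG := clos_sub p m N hM; apply: admissible_subdiv_step => //.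
pose s := sort (relpre (level m) leq) (enum_fset (clos p m N G M)).
have mem_s K : (K \in s) = (K \in clos p m N G M) by rewrite mem_sort.
exists s; split; first by rewrite perm_sort.
apply: sorted_closed_admissible => //.
- exact: good_admissible.
- by apply: sort_sorted => ? ?; exact: leq_total.
- by rewrite sort_uniq.
- by move=> K; rewrite mem_s; exact/fsubsetP.
- by move=> K K'; rewrite !mem_s; exact: clos_closed.
Qed.
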